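(* One has a canonical isomorphism (bijection) $$\mathbb C^\flat\ \xrightarrow{\ \sqrt{\ }\ }\ \{(x^{(j)})_{j\in\mathbb Z},\ x^{(j)}\in\mathbb C,\ \text{convergent for } j\to-\infty\ \mid\ x^{(j+1)}=(x^{(j)})^3\ \ \forall j\in\mathbb Z\}.$$ The map $\sqrt{\ }$ associates to $0$ the sequence $x^{(j)}=0$ and to $x=\epsilon\,e(z)\in\mathbb C^\flat$ the sequence $x^{(j)}=\epsilon\,e^{3^jz}$.
   Context: As a set, $\mathbb C^\flat=(\mathbb C\coprod\mathbb C)\cup\{0\}$ is the union of two copies of $\mathbb C$ and $\{0\}$; its nonzero elements are written uniquely as $\epsilon\,e(z)$ with $\epsilon=\pm1$ and $z\in\mathbb C$ (here $e(z)$ is a formal symbol). Its multiplication is $\epsilon e(z)\cdot\epsilon'e(z')=\epsilon\epsilon'e(z+z')$ (and $0\cdot x=0$). *)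

(* Defs.v *)
From Stdlib Require Import Reals ZArith.
From Coquelicot Require Import Coquelicot.

Inductive sign : Set := Plus | Minus.

Definition sign_mul (e e' : sign) : sign :=
  match e, e' with
  | Plus, s | s, Plus => s
  | Minus, Minus => Plus
  end.

Definition sign_val (e : sign) : C :=
  match e with
  | Plus => RtoC 1
  | Minus => RtoC (-1)
  end.

(** [flat_elt e z] is the formal element e * e(z). *)
Inductive Cflat : Set :=
  | flat_zero : Cflat
  | flat_elt : sign -> C -> Cflat.

Definition Cflat_mul (x y : Cflat) : Cflat :=
  match x, y with
  | flat_elt e z, flat_elt e' z' => flat_elt (sign_mul e e') (z + z')%C
  | _, _ => flat_zero
  end.

Definition Cexp (z : C) : C :=
  (exp (Re z) * cos (Im z), exp (Re z) * sin (Im z))%R.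

(** The neighbourhoods of minus infinity in Z. *)
Definition Z_minfty (P : Z -> Prop) : Prop :=
  exists N : Z, forall j : Z, (j <= N)%Z -> P j.

Definition cubic_seq (s : Z -> C) : Prop :=
  (exists l : C, filterlim s Z_minfty (locally l)) /\
  (forall j : Z, s (j + 1)%Z = (s j ^ 3)%C).

Definition sqrt_flat (x : Cflat) (j : Z) : C :=
  match x with
  | flat_zero => RtoC 0
  | flat_elt e z => (sign_val e * Cexp (RtoC (powerRZ 3 j) * z))%C
  end.

Definition seq_mul (s t : Z -> C) (j : Z) : C := (s j * t j)%C.

(* Main.v *)
Require Import Defs.
From Stdlib Require Import Reals ZArith Lra Lia FunctionalExtensionality.
From Coquelicot Require Import Coquelicot.

Open Scope R_scope.

(** The kernel of the complex exponential is [2 i PI Z], so the exponential is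
    injective on pairs of points whose imaginary parts differ by less than
    [2 PI] ([Cexp_inj_of_close]).  Dividing by powers of 3 brings any two
    points into that situation, and this settles both halves of the bijection.

    Injectivity: far enough towards minus infinity [3^j z] and [3^j z'] have
    imaginary parts below [PI / 2], so the two exponentials have positive real
    part; the signs must then agree, and the exponents too.

    Surjectivity: the limit [l] of a cubic sequence satisfies [l = l^3], hence
    [l] is 0, 1 or -1.  If [l = 0], the moduli are eventually less than 1, hence
    nonincreasing in [j] while tending to 0 as [j] tends to minus infinity; the
    sequence vanishes.  If [l = 1], the terms [s j] lie in the right half-plane
    for [j <= N]; their principal logarithms have imaginary part in
    [(-PI/2, PI/2)], so [3 Log (s (j-1))] and [Log (s j)], which have the same
    exponential, have imaginary parts less than [2 PI] apart and coincide.  Thus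
    [Log (s j) = 3^j z] with [z] independent of [j <= N], and the recursion
    extends [s j = Cexp (3^j z)] to all [j].  The case [l = -1] reduces to this
    one because changing the sign of the sequence preserves the recursion. *)

(** * The complex exponential and the logarithm on the right half-plane *)

Lemma Re_scal (r : R) (z : C) : Re (RtoC r * z)%C = r * Re z.
Proof. unfold Re, Im, Cmult, RtoC; simpl; ring. Qed.

Lemma Im_scal (r : R) (z : C) : Im (RtoC r * z)%C = r * Im z.
Proof. unfold Re, Im, Cmult, RtoC; simpl; ring. Qed.

Lemma Cexp_plus (z w : C) : Cexp (z + w)%C = (Cexp z * Cexp w)%C.
Proof.
  unfold Cexp, Cplus, Cmult, Re, Im; simpl.
  rewrite exp_plus, cos_plus, sin_plus.
  f_equal; ring.
Qed.

Lemma Cexp_cube (z : C) : (Cexp z ^ 3)%C = Cexp (RtoC 3 * z)%C.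
Proof.
  replace (RtoC 3 * z)%C with (z + (z + z))%C.
  - rewrite !Cexp_plus, !Cpow_S. simpl Cpow. ring.
  - destruct z as [a b]; unfold Cplus, Cmult, RtoC; simpl; f_equal; ring.
Qed.

Lemma Re_Cexp_pos (z : C) : Rabs (Im z) < PI / 2 -> 0 < Re (Cexp z).
Proof.
  intros H; apply Rabs_def2 in H; simpl.
  apply Rmult_lt_0_compat; [apply exp_pos | apply cos_gt_0; lra].
Qed.

Lemma cos_eq_1_small (x : R) : Rabs x < 2 * PI -> cos x = 1 -> x = 0.
Proof.
  intros Hx Hc; apply Rabs_def2 in Hx.
  (* [1 - cos x = 2 sin^2 (x/2)] and [x/2] lies in [(-PI, PI)]. *)
  assert (Hs : sin (x / 2) = 0).
  { assert (H := cos_2a_sin (x / 2)).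
    replace (2 * (x / 2)) with x in H by field.
    apply Rsqr_0_uniq; unfold Rsqr; lra. }
  destruct (Rtotal_order x 0) as [H | [H | H]]; [exfalso | exact H | exfalso].
  - assert (0 < sin (- (x / 2))) by (apply sin_gt_0; lra).
    rewrite sin_neg in *; lra.
  - assert (0 < sin (x / 2)) by (apply sin_gt_0; lra). lra.
Qed.

Lemma Cexp_inj_of_close (z w : C) :
  Rabs (Im z - Im w) < 2 * PI -> Cexp z = Cexp w -> z = w.
Proof.
  destruct z as [a b], w as [c d]; unfold Cexp; simpl; intros Hclose H.
  injection H as Hc Hs.
  assert (Hb := sin2_cos2 b); assert (Hd := sin2_cos2 d); unfold Rsqr in Hb, Hd.
  assert (Ea := exp_pos a); assert (Ec := exp_pos c).
  (* The moduli agree, which gives the real parts. *)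
  assert (Hsq : exp a * exp a = exp c * exp c).
  { replace (exp a * exp a) with
      ((exp a * cos b) * (exp a * cos b) + (exp a * sin b) * (exp a * sin b)).
    - rewrite Hc, Hs.
      transitivity (exp c * exp c * (sin d * sin d + cos d * cos d)); [ring |].
      rewrite Hd; ring.
    - transitivity (exp a * exp a * (sin b * sin b + cos b * cos b)); [ring |].
      rewrite Hb; ring. }
  assert (He : exp a = exp c) by nra.
  rewrite He in Hc, Hs.
  apply Rmult_eq_reg_l in Hc; [| lra].
  apply Rmult_eq_reg_l in Hs; [| lra].
  assert (Hbd : b - d = 0).
  { apply cos_eq_1_small; [exact Hclose |].
    rewrite cos_minus, Hc, Hs; lra. }
  f_equal; [now apply exp_inv | lra].
Qed.

(** On the right half-plane the argument of [x + i y] is [atan (y / x)]; this is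
    the principal logarithm there. *)
Definition Clog (u : C) : C := (ln (Cmod u), atan (Im u / Re u)).

Lemma Im_Clog_bound (u : C) : Rabs (Im (Clog u)) < PI / 2.
Proof.
  simpl; destruct (atan_bound (Im u / Re u)); apply Rabs_def1; lra.
Qed.

Lemma Cexp_Clog (u : C) : 0 < Re u -> Cexp (Clog u) = u.
Proof.
  destruct u as [a b]; simpl; intros Ha.
  assert (Hm : 0 < Cmod (a, b)).
  { apply Cmod_gt_0; intros E; injection E; lra. }
  unfold Cexp, Clog; simpl; rewrite exp_ln by exact Hm.
  assert (Hsqrt : sqrt (1 + (b / a)²) = Cmod (a, b) / a).
  { unfold Cmod; simpl fst; simpl snd.
    replace (1 + (b / a)²) with ((a ^ 2 + b ^ 2) / (a * a))
      by (unfold Rsqr; field; lra).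
    rewrite sqrt_div_alt by nra. rewrite sqrt_square by lra. reflexivity. }
  rewrite cos_atan, sin_atan, Hsqrt.
  f_equal; field; split; lra.
Qed.

(** The two sides have the same exponential, and their imaginary parts are
    below [PI / 2] and [3 PI / 2] in absolute value, so less than [2 PI] apart. *)
Lemma Clog_cube (u : C) :
  0 < Re u -> 0 < Re (u ^ 3)%C -> Clog (u ^ 3)%C = (RtoC 3 * Clog u)%C.
Proof.
  intros Hu Hu3.
  apply Cexp_inj_of_close.
  - assert (H1 := Im_Clog_bound (u ^ 3)%C); assert (H2 := Im_Clog_bound u).
    rewrite Im_scal.
    apply Rabs_def2 in H1; apply Rabs_def2 in H2; apply Rabs_def1; lra.
  - now rewrite <- Cexp_cube, !Cexp_Clog.
Qed.

(** * Limits at minus infinity *)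

Global Instance Z_minfty_proper : ProperFilter Z_minfty.
Proof.
  constructor.
  - intros P [N HN]; exists N; apply HN; lia.
  - constructor.
    + now exists 0%Z.
    + intros P Q [N HN] [M HM]; exists (Z.min N M); intros j Hj.
      split; [apply HN | apply HM]; lia.
    + intros P Q H [N HN]; exists N; auto.
Qed.

Lemma filterlim_succ_minfty : filterlim (fun j => (j + 1)%Z) Z_minfty Z_minfty.
Proof.
  intros P [N HN]; exists (N - 1)%Z; intros j Hj; apply HN; lia.
Qed.

Lemma powerRZ_3_succ (j : Z) : powerRZ 3 (j + 1) = 3 * powerRZ 3 j.
Proof.
  rewrite powerRZ_add by lra; simpl; ring.
Qed.

Lemma filterlim_powerRZ_3 : filterlim (powerRZ 3) Z_minfty (locally 0).
Proof.
  apply filterlim_ext_loc with (fun j => (1 / 3) ^ Z.to_nat (- j)).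
  - exists 0%Z; intros j Hj.
    destruct (Z_of_nat_complete (- j)) as [n Hn]; [lia |].
    replace j with (- Z.of_nat n)%Z by lia.
    rewrite Z.opp_involutive, Nat2Z.id, powerRZ_neg', <- pow_powerRZ.
    unfold Rdiv; rewrite Rmult_1_l, pow_inv; reflexivity.
  - apply (filterlim_comp _ _ _ (fun j => Z.to_nat (- j)) (pow (1 / 3))
             _ eventually).
    + intros P [N HN]; exists (- Z.of_nat N)%Z; intros j Hj; apply HN; lia.
    + apply (is_lim_seq_geom (1 / 3)); rewrite Rabs_pos_eq; lra.
Qed.

Lemma filterlim_powerRZ_3_mult (x : R) :
  filterlim (fun j => powerRZ 3 j * x) Z_minfty (locally 0).
Proof.
  apply (filterlim_comp _ _ _ (powerRZ 3) (fun t => t * x) _ (locally 0)).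
  - exact filterlim_powerRZ_3.
  - replace (locally 0) with (locally (0 * x)) at 2 by (f_equal; ring).
    apply (continuous_mult (K := R_AbsRing) (fun t : R => t) (fun _ => x) 0).
    + apply continuous_id.
    + apply continuous_const.
Qed.

Lemma powerRZ_3_mult_small (x eps : R) :
  0 < eps -> Z_minfty (fun j => Rabs (powerRZ 3 j * x) < eps).
Proof.
  intros He.
  assert (H := filterlim_powerRZ_3_mult x).
  rewrite filterlim_locally in H.
  apply filter_imp with (2 := H (mkposreal eps He)).
  intros j Hj; unfold ball in Hj; simpl in Hj.
  unfold AbsRing_ball, abs, minus, plus, opp in Hj; simpl in Hj.
  now rewrite Ropp_0, Rplus_0_r in Hj.
Qed.

Section ComplexLimits.

Context {T : Type} {F : (T -> Prop) -> Prop} {FF : Filter F}.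

Lemma filterlim_C_iff (f : T -> C) (l : C) :
  filterlim f F (locally l) <->
  filterlim (fun t => Re (f t)) F (locally (Re l)) /\
  filterlim (fun t => Im (f t)) F (locally (Im l)).
Proof.
  rewrite !filterlim_locally; split.
  - intros H; split; intros eps; apply filter_imp with (2 := H eps);
      intros t Ht; apply Ht.
  - intros [HR HI] eps.
    apply filter_imp with (2 := filter_and _ _ (HR eps) (HI eps)).
    intros t [Ht1 Ht2]; split; assumption.
Qed.

Lemma filterlim_Rplus (f g : T -> R) (x y : R) :
  filterlim f F (locally x) -> filterlim g F (locally y) ->
  filterlim (fun t => f t + g t) F (locally (x + y)).
Proof.
  intros Hf Hg.
  exact (filterlim_comp_2 _ _ _ Hf Hg
           (filterlim_plus (V := R_NormedModule) x y)).
Qed.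

Lemma filterlim_Rmult (f g : T -> R) (x y : R) :
  filterlim f F (locally x) -> filterlim g F (locally y) ->
  filterlim (fun t => f t * g t) F (locally (x * y)).
Proof.
  intros Hf Hg.
  exact (filterlim_comp_2 _ _ _ Hf Hg (filterlim_mult (K := R_AbsRing) x y)).
Qed.

Lemma filterlim_Ropp (f : T -> R) (x : R) :
  filterlim f F (locally x) -> filterlim (fun t => - f t) F (locally (- x)).
Proof.
  intros Hf.
  exact (filterlim_comp _ _ _ f _ _ _ _ Hf
           (filterlim_opp (V := R_NormedModule) x)).
Qed.

Lemma filterlim_Cmult (f g : T -> C) (x y : C) :
  filterlim f F (locally x) -> filterlim g F (locally y) ->
  filterlim (fun t => (f t * g t)%C) F (locally (x * y)%C).
Proof.
  rewrite !filterlim_C_iff; intros [HfR HfI] [HgR HgI]; simpl.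
  split.
  - apply filterlim_Rplus; [| apply filterlim_Ropp]; now apply filterlim_Rmult.
  - apply filterlim_Rplus; now apply filterlim_Rmult.
Qed.

End ComplexLimits.

Lemma filterlim_Cexp_powerRZ_3 (z : C) :
  filterlim (fun j => Cexp (RtoC (powerRZ 3 j) * z)%C) Z_minfty
    (locally (RtoC 1)).
Proof.
  assert (Hc : forall (f : R -> R) (x : R),
    (forall t : R_UniformSpace, continuous f t) ->
    filterlim (fun j => f (powerRZ 3 j * x)) Z_minfty (locally (f 0))).
  { intros f x Hf.
    exact (filterlim_comp _ _ _ _ f _ _ _ (filterlim_powerRZ_3_mult x) (Hf 0)). }
  apply (filterlim_ext (fun j =>
    (exp (powerRZ 3 j * Re z) * cos (powerRZ 3 j * Im z),
     exp (powerRZ 3 j * Re z) * sin (powerRZ 3 j * Im z)) : C)).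
  { intros j; unfold Cexp; now rewrite Re_scal, Im_scal. }
  replace (RtoC 1) with ((exp 0 * cos 0, exp 0 * sin 0) : C)
    by (rewrite exp_0, cos_0, sin_0; unfold RtoC; f_equal; ring).
  apply filterlim_C_iff; split; apply filterlim_Rmult; apply Hc;
    first [exact continuous_exp | exact continuous_cos | exact continuous_sin].
Qed.

(** * The map to cubic sequences *)

Lemma Ccube (u : C) : (u ^ 3)%C = (u * (u * u))%C.
Proof. rewrite !Cpow_S; simpl Cpow; ring. Qed.

Lemma sign_val_sqr (e : Defs.sign) : (sign_val e * sign_val e)%C = RtoC 1.
Proof. destruct e; simpl; rewrite <- RtoC_mult; f_equal; ring. Qed.

Lemma sign_val_mul (e e' : Defs.sign) :
  sign_val (sign_mul e e') = (sign_val e * sign_val e')%C.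
Proof. destruct e, e'; simpl; rewrite <- RtoC_mult; f_equal; ring. Qed.

Lemma sign_mult_cube (e : Defs.sign) (u : C) :
  ((sign_val e * u) ^ 3)%C = (sign_val e * u ^ 3)%C.
Proof.
  rewrite !Ccube.
  transitivity ((sign_val e * sign_val e) * (sign_val e * (u * (u * u))))%C;
    [ring |].
  rewrite sign_val_sqr; ring.
Qed.

Lemma sign_mult_invol (e : Defs.sign) (u : C) :
  (sign_val e * (sign_val e * u))%C = u.
Proof. rewrite Cmult_assoc, sign_val_sqr; ring. Qed.

Lemma Cexp_powerRZ_3_succ (j : Z) (z : C) :
  Cexp (RtoC (powerRZ 3 (j + 1)) * z)%C = (Cexp (RtoC (powerRZ 3 j) * z) ^ 3)%C.
Proof.
  rewrite Cexp_cube, powerRZ_3_succ, RtoC_mult. f_equal; ring.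
Qed.

Lemma cubic_seq_sqrt_flat (x : Cflat) : cubic_seq (sqrt_flat x).
Proof.
  destruct x as [| e z]; split.
  - exists (RtoC 0); exact (filterlim_const (RtoC 0)).
  - intros j; rewrite Ccube; unfold sqrt_flat; ring.
  - exists (sign_val e * RtoC 1)%C.
    apply filterlim_Cmult;
      [exact (filterlim_const (sign_val e)) | apply filterlim_Cexp_powerRZ_3].
  - intros j; unfold sqrt_flat; rewrite Cexp_powerRZ_3_succ; symmetry.
    apply sign_mult_cube.
Qed.

Lemma sqrt_flat_mul (x y : Cflat) :
  sqrt_flat (Cflat_mul x y) = seq_mul (sqrt_flat x) (sqrt_flat y).
Proof.
  apply functional_extensionality; intros j; unfold seq_mul.
  destruct x as [| e z], y as [| e' z']; simpl; try ring.
  rewrite sign_val_mul, Cmult_plus_distr_l, Cexp_plus; ring.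
Qed.

(** * Injectivity *)

(** This recovers the sign [e] from the sequence, and separates the sequence
    from 0. *)
Lemma sqrt_flat_half_plane (e : Defs.sign) (z : C) :
  Z_minfty (fun j => 0 < Re (sign_val e * sqrt_flat (flat_elt e z) j)%C).
Proof.
  assert (HPI : 0 < PI / 2) by (assert (H := PI_RGT_0); lra).
  apply filter_imp with (2 := powerRZ_3_mult_small (Im z) (PI / 2) HPI).
  intros j Hj; simpl sqrt_flat; rewrite sign_mult_invol.
  apply Re_Cexp_pos; now rewrite Im_scal.
Qed.

Lemma sqrt_flat_elt_neq_zero (e : Defs.sign) (z : C) :
  sqrt_flat (flat_elt e z) <> sqrt_flat flat_zero.
Proof.
  intros H.
  destruct (filter_ex _ (sqrt_flat_half_plane e z)) as [j Hj].
  rewrite H in Hj; simpl sqrt_flat in Hj; rewrite Cmult_0_r in Hj.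
  simpl in Hj; lra.
Qed.

Lemma sqrt_flat_sign_inj (e e' : Defs.sign) (z z' : C) :
  sqrt_flat (flat_elt e z) = sqrt_flat (flat_elt e' z') -> e = e'.
Proof.
  intros H.
  destruct (filter_ex _ (filter_and _ _ (sqrt_flat_half_plane e z)
                           (sqrt_flat_half_plane e' z'))) as [j [H1 H2]].
  rewrite H in H1.
  destruct e, e'; try reflexivity; exfalso;
    unfold sign_val in H1, H2; rewrite Re_scal in H1, H2; lra.
Qed.

Lemma sqrt_flat_inj (x y : Cflat) : sqrt_flat x = sqrt_flat y -> x = y.
Proof.
  destruct x as [| e z], y as [| e' z']; intros H.
  - reflexivity.
  - now destruct (sqrt_flat_elt_neq_zero e' z').
  - now destruct (sqrt_flat_elt_neq_zero e z).
  - assert (He := sqrt_flat_sign_inj _ _ _ _ H); subst e'; f_equal.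
    assert (HPI : 0 < 2 * PI) by (assert (HP := PI_RGT_0); lra).
    destruct (filter_ex _ (powerRZ_3_mult_small (Im z - Im z') _ HPI))
      as [j Hj].
    assert (Hjz : (RtoC (powerRZ 3 j) * z = RtoC (powerRZ 3 j) * z')%C).
    { apply Cexp_inj_of_close.
      - now rewrite !Im_scal, <- Rmult_minus_distr_l.
      - rewrite <- (sign_mult_invol e (Cexp (RtoC (powerRZ 3 j) * z)%C)).
        rewrite <- (sign_mult_invol e (Cexp (RtoC (powerRZ 3 j) * z')%C)).
        f_equal; exact (f_equal (fun s => s j) H). }
    assert (Hp : powerRZ 3 j <> 0) by (apply powerRZ_NOR; lra).
    apply (f_equal (Cmult (/ RtoC (powerRZ 3 j))%C)) in Hjz.
    rewrite !Cmult_assoc, Cinv_l, !Cmult_1_l in Hjz by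
      (intros E; apply Hp; now apply RtoC_inj).
    exact Hjz.
Qed.

(** * Surjectivity *)

Lemma cubic_limit_fixed (s : Z -> C) (l : C) :
  (forall j : Z, s (j + 1)%Z = (s j ^ 3)%C) ->
  filterlim s Z_minfty (locally l) -> (l ^ 3)%C = l.
Proof.
  intros Hs Hl.
  apply (filterlim_locally_unique (V := C_NormedModule) (F := Z_minfty)
           (fun j => s (j + 1)%Z)).
  - apply (filterlim_ext (fun j => (s j * (s j * s j))%C)).
    + intros j; rewrite Hs; symmetry; apply Ccube.
    + rewrite Ccube; repeat apply filterlim_Cmult; exact Hl.
  - exact (filterlim_comp _ _ _ _ s _ _ _ filterlim_succ_minfty Hl).
Qed.

Lemma Ccube_fixed (l : C) :
  (l ^ 3)%C = l -> l = RtoC 0 \/ exists e : Defs.sign, l = sign_val e.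
Proof.
  rewrite Ccube; intros H.
  destruct (Ceq_dec l 0) as [H0 | H0]; [now left | right].
  destruct (Ceq_dec (l - 1) 0) as [H1 | H1].
  { exists Plus; simpl.
    replace l with (l - 1 + 1)%C by ring; rewrite H1; ring. }
  destruct (Ceq_dec (l + 1) 0) as [H2 | H2].
  { exists Minus; simpl.
    replace (RtoC (-1)) with (- RtoC 1)%C
      by (rewrite <- RtoC_opp; f_equal; ring).
    replace l with (l + 1 - 1)%C by ring; rewrite H2; ring. }
  exfalso; apply (Cmult_neq_0 _ _ (Cmult_neq_0 _ _ H0 H1) H2).
  transitivity (l * (l * l) - l)%C; [ring | rewrite H; ring].
Qed.

(** Only the upward direction is available: cubing is not injective, so equality
    at one index would not propagate downwards. *)
Lemma cubic_eq_of_eventually (s t : Z -> C) :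
  (forall j : Z, s (j + 1)%Z = (s j ^ 3)%C) ->
  (forall j : Z, t (j + 1)%Z = (t j ^ 3)%C) ->
  Z_minfty (fun j => s j = t j) -> s = t.
Proof.
  intros Hs Ht [N HN].
  assert (Hup : forall n : nat, s (N + Z.of_nat n)%Z = t (N + Z.of_nat n)%Z).
  { induction n as [| n IH].
    - apply HN; lia.
    - replace (N + Z.of_nat (S n))%Z with (N + Z.of_nat n + 1)%Z by lia.
      now rewrite Hs, Ht, IH. }
  apply functional_extensionality; intros j.
  destruct (Z_le_gt_dec j N) as [Hj | Hj]; [now apply HN |].
  replace j with (N + Z.of_nat (Z.to_nat (j - N)))%Z by lia.
  apply Hup.
Qed.

(** Below some index all moduli are less than 1, where cubing decreases them.  A
    nonzero term would then bound from below the moduli of all earlier terms,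
    which tend to 0. *)
Lemma cubic_limit_0 (s : Z -> C) :
  (forall j : Z, s (j + 1)%Z = (s j ^ 3)%C) ->
  filterlim s Z_minfty (locally (RtoC 0)) -> Z_minfty (fun j => s j = RtoC 0).
Proof.
  intros Hs Hl.
  assert (Hsmall : forall eps, 0 < eps -> Z_minfty (fun j => Cmod (s j) < eps)).
  { intros eps He.
    assert (H2 : 0 < sqrt 2) by (apply sqrt_lt_R0; lra).
    assert (He2 : 0 < eps / sqrt 2) by now apply Rdiv_lt_0_compat.
    assert (H := proj1 (filterlim_locally _ _) Hl (mkposreal _ He2)).
    apply filter_imp with (2 := H); intros j Hj.
    apply (C_NormedModule_mixin_compat2 (RtoC 0) (s j)) in Hj; simpl in Hj.
    replace (sqrt 2 * (eps / sqrt 2)) with eps in Hj by (field; lra).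
    replace (s j) with (minus (s j) (RtoC 0)); [exact Hj |].
    unfold minus, plus, opp; simpl; ring. }
  destruct (Hsmall 1 Rlt_0_1) as [N HN]; exists N; intros j Hj.
  apply Cmod_eq_0.
  destruct (Rle_lt_or_eq_dec _ _ (Cmod_ge_0 (s j))) as [Hpos | Hz];
    [exfalso | now symmetry].
  assert (Hback : forall n : nat, Cmod (s j) <= Cmod (s (j - Z.of_nat n)%Z)).
  { induction n as [| n IH].
    - replace (j - Z.of_nat 0)%Z with j by lia; lra.
    - apply Rle_trans with (1 := IH).
      replace (j - Z.of_nat n)%Z with (j - Z.of_nat (S n) + 1)%Z by lia.
      rewrite Hs, Cmod_pow.
      assert (H1 : Cmod (s (j - Z.of_nat (S n))%Z) < 1) by (apply HN; lia).
      assert (H0 := Cmod_ge_0 (s (j - Z.of_nat (S n))%Z)).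
      set (r := Cmod (s (j - Z.of_nat (S n))%Z)) in *; simpl.
      assert (r * r <= 1) by nra; nra. }
  destruct (Hsmall _ Hpos) as [M HM].
  assert (H := HM (Z.min j M) ltac:(lia)).
  assert (Hb := Hback (Z.to_nat (j - Z.min j M))).
  replace (j - Z.of_nat (Z.to_nat (j - Z.min j M)))%Z with (Z.min j M) in Hb
    by lia.
  lra.
Qed.

(** A point [s j] of the right half-plane has a single cube root there, the one
    given by a third of the principal logarithm; this must be [s (j-1)], so that [Log (s j)] is a fixed multiple of [3^j]. *)
Lemma cubic_limit_1 (s : Z -> C) :
  (forall j : Z, s (j + 1)%Z = (s j ^ 3)%C) ->
  filterlim s Z_minfty (locally (RtoC 1)) ->
  exists z : C, s = (fun j => Cexp (RtoC (powerRZ 3 j) * z)%C).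
Proof.
  intros Hs Hl.
  assert (Hpos : Z_minfty (fun j => 0 < Re (s j))).
  { apply filterlim_C_iff in Hl; destruct Hl as [Hl _].
    apply (Hl (fun x => 0 < x)); simpl.
    apply (open_gt 0); lra. }
  destruct Hpos as [N HN].
  (* The exponent is read off from the term of index [N]. *)
  exists (RtoC (powerRZ 3 (- N)) * Clog (s N))%C.
  set (z := (RtoC (powerRZ 3 (- N)) * Clog (s N))%C).
  assert (Hlog : forall n : nat, Clog (s (N - Z.of_nat n)%Z) =
                   (RtoC (powerRZ 3 (N - Z.of_nat n)) * z)%C).
  { induction n as [| n IH].
    - replace (N - Z.of_nat 0)%Z with N by lia.
      unfold z; rewrite Cmult_assoc, <- RtoC_mult, <- powerRZ_add by lra.
      replace (N + - N)%Z with 0%Z by lia; simpl; ring.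
    - set (k := (N - Z.of_nat (S n))%Z) in *.
      replace (N - Z.of_nat n)%Z with (k + 1)%Z in IH by (unfold k; lia).
      assert (Hk : 0 < Re (s k)) by (apply HN; unfold k; lia).
      assert (Hk1 : 0 < Re (s (k + 1)%Z)) by (apply HN; unfold k; lia).
      rewrite Hs in IH, Hk1.
      rewrite Clog_cube, powerRZ_3_succ, RtoC_mult in IH by assumption.
      apply (f_equal (Cmult (/ RtoC 3)%C)) in IH.
      assert (H3 : RtoC 3 <> RtoC 0) by (intros E; apply RtoC_inj in E; lra).
      rewrite !Cmult_assoc, Cinv_l, !Cmult_1_l in IH by exact H3.
      exact IH. }
  apply cubic_eq_of_eventually; [exact Hs | |].
  - intros j; apply Cexp_powerRZ_3_succ.
  - exists N; intros j Hj.
    assert (H := Hlog (Z.to_nat (N - j))).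
    replace (N - Z.of_nat (Z.to_nat (N - j)))%Z with j in H by lia.
    rewrite <- H; symmetry; apply Cexp_Clog, HN, Hj.
Qed.

Lemma sqrt_flat_surj (s : Z -> C) :
  cubic_seq s -> exists x : Cflat, sqrt_flat x = s.
Proof.
  intros [[l Hl] Hs].
  destruct (Ccube_fixed l (cubic_limit_fixed s l Hs Hl)) as [H0 | [e He]].
  - subst l; exists flat_zero; symmetry.
    apply cubic_eq_of_eventually; [exact Hs | |].
    + apply (cubic_seq_sqrt_flat flat_zero).
    + now apply cubic_limit_0.
  - subst l.
    destruct (cubic_limit_1 (fun j => (sign_val e * s j)%C)) as [z Hz].
    + intros j; rewrite Hs; symmetry; apply sign_mult_cube.
    + rewrite <- (sign_val_sqr e).
      apply filterlim_Cmult; [exact (filterlim_const (sign_val e)) | exact Hl].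
    + exists (flat_elt e z); apply functional_extensionality; intros j; simpl.
      rewrite <- (sign_mult_invol e (s j)).
      f_equal; symmetry; exact (f_equal (fun t => t j) Hz).
Qed.

Theorem theorem7p6 :
  (forall x : Cflat, cubic_seq (sqrt_flat x)) /\
  (forall x y : Cflat, sqrt_flat x = sqrt_flat y -> x = y) /\
  (forall s : Z -> C, cubic_seq s -> exists x : Cflat, sqrt_flat x = s) /\
  (forall x y : Cflat,
     sqrt_flat (Cflat_mul x y) = seq_mul (sqrt_flat x) (sqrt_flat y)).
Proof.
  split; [exact cubic_seq_sqrt_flat |].
  split; [exact sqrt_flat_inj |].
  split; [exact sqrt_flat_surj | exact sqrt_flat_mul].
Qed.
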